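(* There exists a universal constant $K>0$ such that the following holds. (i) For any $\theta\ge0$ and $T\ge K/\theta$, there is an algorithm which, given one copy each of unknown $d$-dimensional states $\rho_1,\dots,\rho_T,\sigma_1,\dots,\sigma_T$ (i.e., given $\rho_1\otimes\cdots\otimes\rho_T\otimes\sigma_1\otimes\cdots\otimes\sigma_T$), distinguishes with probability at least $0.99$ the case $D_{\mathrm{HS}}^2(\rho_{\mathrm{avg}},\sigma_{\mathrm{avg}})\le0.99\,\theta$ from the case $D_{\mathrm{HS}}^2(\rho_{\mathrm{avg}},\sigma_{\mathrm{avg}})>\theta$. (ii) For any $\varepsilon>0$ and $T\ge K\cdot\frac{d}{\varepsilon^2}$, there is such an algorithm distinguishing with probability at least $0.99$ the case $\rho_{\mathrm{avg}}=\sigma_{\mathrm{avg}}$ from the case $D_{\mathrm{tr}}(\rho_{\mathrm{avg}},\sigma_{\mathrm{avg}})>\varepsilon$. Here $\rho_{\mathrm{avg}}=\frac1T\sum_t\rho_t$ and $\sigma_{\mathrm{avg}}=\frac1T\sum_t\sigma_t$.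
   Context: $D_{\mathrm{HS}}^2(\rho,\sigma)=\mathrm{Tr}[(\rho-\sigma)^2]$ and $D_{\mathrm{tr}}(\rho,\sigma)=\frac12\|\rho-\sigma\|_1$. The algorithm may apply any quantum measurement to the given $2T$-fold product state (chosen depending on $d,T$ and the distance parameter only) and outputs accept/reject; ''distinguishes with probability at least $0.99$'' means it accepts with probability at least $0.99$ in the first case and rejects with probability at least $0.99$ in the second case. *)

(* Defs.v *)
From HB Require Import structures.
From mathcomp Require Import all_boot all_order all_algebra.
From mathcomp Require Import reals.
From mathcomp Require Import complex.
Set Implicit Arguments. Unset Strict Implicit. Unset Printing Implicit Defensive.
Import Order.TTheory GRing.Theory Num.Theory.
Local Open Scope ring_scope.

Section QDefs.
Variable R : realType.
Local Notation C := R[i].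

Definition adjmx m n (A : 'M[C]_(m, n)) : 'M[C]_(n, m) := map_mx conjc A^T.

Definition hermitian n (A : 'M[C]_n) : Prop := adjmx A = A.

Definition psd n (A : 'M[C]_n) : Prop :=
  hermitian A /\ forall v : 'cV[C]_n, 0 <= complex.Re ((adjmx v *m A *m v) 0 0).

Definition is_state n (A : 'M[C]_n) : Prop := psd A /\ \tr A = 1.

(* two-outcome measurement: M is the "accept" POVM element, 1 - M "reject" *)
Definition is_effect n (M : 'M[C]_n) : Prop := psd M /\ psd (1%:M - M).

Definition avg_state d T (rho : 'I_T -> 'M[C]_d) : 'M[C]_d :=
  (T%:R)^-1 *: \sum_(t < T) rho t.

(* D_HS^2(A,B) = Tr[(A-B)^2] (real for Hermitian A, B) *)
Definition DHS2 d (A B : 'M[C]_d) : R := complex.Re (\tr ((A - B) *m (A - B))).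

(* ||A||_1 = Tr sqrt(A^* A), where sqrt is the (unique) PSD square root. *)
Definition is_trace_norm n (A : 'M[C]_n) (t : R) : Prop :=
  exists S : 'M[C]_n, [/\ psd S, S *m S = adjmx A *m A & complex.Re (\tr S) = t].

Definition Dtr_gt d (A B : 'M[C]_d) (eps : R) : Prop :=
  exists t, is_trace_norm (A - B) t /\ eps < t / 2.

(* computational basis of (C^d)^{⊗ 2T}: functions 'I_(T+T) -> 'I_d *)
Definition basis_idx d T := {ffun 'I_(T + T) -> 'I_d}.
Definition prod_dim d T := #|{: basis_idx d T}|.

(* rho_1 ⊗ ... ⊗ rho_T ⊗ sigma_1 ⊗ ... ⊗ sigma_T, written in the product
   basis (enumerated by enum_val) *)
Definition prod_state d T (rho sigma : 'I_T -> 'M[C]_d) :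
  'M[C]_(prod_dim d T) :=
  \matrix_(i, j)
    \prod_(k < T + T)
      (match split k with inl t => rho t | inr t => sigma t end)
        ((enum_val i : basis_idx d T) k) ((enum_val j : basis_idx d T) k).

Definition accept_prob d T (M : 'M[C]_(prod_dim d T))
  (rho sigma : 'I_T -> 'M[C]_d) : R :=
  complex.Re (\tr (M *m prod_state rho sigma)).

End QDefs.

(* Main.v *)
Require Import Defs.
From HB Require Import structures.
From mathcomp Require Import all_boot all_order all_algebra.
From mathcomp Require Import reals.
From mathcomp Require Import complex.
From mathcomp Require Import ring lra.
(* Again, because [all_algebra] has an unrelated abbreviation [hermitian]. *)
Import Defs.
Import Order.TTheory GRing.Theory Num.Theory.
Local Open Scope ring_scope.
Set Implicit Arguments. Unset Strict Implicit. Unset Printing Implicit Defensive.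

(* Let w_1, ..., w_2T be the given states, with signs s_k = 1 for the rho_t and
   s_k = -1 for the sigma_t, and put D = sum_k s_k w_k = T (rho_avg - sigma_avg).
   The observable O = sum_(k <> l) s_k s_l SWAP_kl has mean
   Tr D^2 - sum_k Tr w_k^2, which is T^2 D_HS^2 up to an error of at most 2T.
   Its Hoeffding decomposition into a linear part and a doubly centered quadratic
   part, whose summands have uncorrelated products, bounds the variance by
   O(T Tr D^2 + T^2).  Accepting on the spectral subspace O <= 0.995 theta T^2
   works by Chebyshev's inequality once T theta is a large constant.
   Part (ii) is part (i) with theta = eps^2 / d, since ||A||_1^2 <= d Tr A^2. *)

(** * Hermitian and positive semidefinite matrices *)

(** The variance identity for [A] in [B], purely algebraic. It serves twice: for the linear part of
    the statistic and, with [B] maximally mixed, as Cauchy-Schwarz for the trace norm. *)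
Lemma mxtrace_centered_sqr (F : comNzRingType) n (A B : 'M[F]_n) : \tr B = 1 ->
  let h := \tr (A *m B) in
  \tr ((A - h%:M) *m (A - h%:M) *m B) = \tr (A *m A *m B) - h * h.
Proof.
move=> B1 h; have trB := raddfB (@mxtrace F n).
have h1 : \tr ((A - h%:M) *m B) = 0.
  by rewrite mulmxBl trB /= mul_scalar_mx mxtraceZ B1 mulr1 subrr.
rewrite mulmxBl mulmxBl trB /= mul_scalar_mx -[X in _ - \tr X]scalemxAl mxtraceZ h1 mulr0 subr0.
by rewrite mulmxBr mulmxBl trB /= mul_mx_scalar -scalemxAl mxtraceZ.
Qed.

Section HermitianMatrices.
Variable R : realType.
Local Notation C := R[i].
Local Notation Re := (@complex.Re R).
Local Notation Im := (@complex.Im R).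
Local Notation rc := (real_complex R).

Lemma ReD (x y : C) : Re (x + y) = Re x + Re y. Proof. by case: x; case: y. Qed.
Lemma ReN (x : C) : Re (- x) = - Re x. Proof. by case: x. Qed.
Lemma ReB (x y : C) : Re (x - y) = Re x - Re y. Proof. by rewrite ReD ReN. Qed.
Lemma Re_sum (I : Type) (r : seq I) (P : pred I) (F : I -> C) :
  Re (\sum_(i <- r | P i) F i) = \sum_(i <- r | P i) Re (F i).
Proof. exact: (big_morph _ ReD). Qed.
Lemma ReZ (a : R) (x : C) : Re (rc a * x) = a * Re x.
Proof. by case: x => x y /=; rewrite mul0r subr0. Qed.

(** Either conjugate times [z] is the squared modulus. This gives access to the spectral theorem for
    normal matrices, stated with the generic conjugation. *)
Lemma conjc_conjC (z : C) : conjc z = (z^*)%R.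
Proof.
have [->|z0] := eqVneq z 0; first by rewrite conjc0 rmorph0.
by apply: (mulfI z0); rewrite -sqr_normc normCK.
Qed.

Lemma conjc_fixed_real (z : C) : conjc z = z -> z = rc (Re z).
Proof. by case: z => x y [] h; congr Complex => /=; lra. Qed.

Lemma adjmxE m n (A : 'M[C]_(m, n)) i j : adjmx A i j = conjc (A j i).
Proof. by rewrite !mxE. Qed.

Lemma adjmxM m n p (A : 'M[C]_(m, n)) (B : 'M[C]_(n, p)) :
  adjmx (A *m B) = adjmx B *m adjmx A.
Proof. by rewrite /adjmx trmx_mul map_mxM. Qed.

Lemma adjmxD m n (A B : 'M[C]_(m, n)) : adjmx (A + B) = adjmx A + adjmx B.
Proof. by rewrite /adjmx raddfD /= map_mxD. Qed.

Lemma adjmxN m n (A : 'M[C]_(m, n)) : adjmx (- A) = - adjmx A.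
Proof. by rewrite /adjmx raddfN /= map_mxN. Qed.

Lemma adjmxZ m n a (A : 'M[C]_(m, n)) : adjmx (a *: A) = conjc a *: adjmx A.
Proof. by rewrite /adjmx linearZ /= map_mxZ. Qed.

Lemma adjmxK m n (A : 'M[C]_(m, n)) : adjmx (adjmx A) = A.
Proof. by apply/matrixP => i j; rewrite !adjmxE conjcK. Qed.

Lemma adjmx_scalar n (a : C) : adjmx a%:M = (conjc a)%:M :> 'M[C]_n.
Proof. by rewrite /adjmx tr_scalar_mx map_scalar_mx. Qed.

Lemma adjmx_sum m n (I : Type) (r : seq I) (P : pred I) (F : I -> 'M[C]_(m, n)) :
  adjmx (\sum_(i <- r | P i) F i) = \sum_(i <- r | P i) adjmx (F i).
Proof.
apply: (big_morph _ (@adjmxD m n)).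
by apply/matrixP => i j; rewrite adjmxE !mxE conjc0.
Qed.

Lemma mxtrace_adjmx n (A : 'M[C]_n) : \tr (adjmx A) = conjc (\tr A).
Proof. by rewrite /mxtrace rmorph_sum; apply: eq_bigr => i _; rewrite adjmxE. Qed.

Lemma hermitianD n (A B : 'M[C]_n) : hermitian A -> hermitian B -> hermitian (A + B).
Proof. by rewrite /hermitian adjmxD => -> ->. Qed.
Lemma hermitianN n (A : 'M[C]_n) : hermitian A -> hermitian (- A).
Proof. by rewrite /hermitian adjmxN => ->. Qed.
Lemma hermitianB n (A B : 'M[C]_n) : hermitian A -> hermitian B -> hermitian (A - B).
Proof. by move=> hA hB; apply/hermitianD/hermitianN. Qed.
Lemma hermitianZ n a (A : 'M[C]_n) : conjc a = a -> hermitian A -> hermitian (a *: A).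
Proof. by rewrite /hermitian adjmxZ => -> ->. Qed.
Lemma hermitian_scalar n (a : C) : conjc a = a -> hermitian (a%:M : 'M[C]_n).
Proof. by rewrite /hermitian adjmx_scalar => ->. Qed.
Lemma hermitian_sum n (I : Type) (r : seq I) (P : pred I) (F : I -> 'M[C]_n) :
  (forall i, P i -> hermitian (F i)) -> hermitian (\sum_(i <- r | P i) F i).
Proof. by move=> h; rewrite /hermitian adjmx_sum; apply: eq_bigr. Qed.

Lemma conjc_mxtraceM n (A B : 'M[C]_n) :
  hermitian A -> hermitian B -> conjc (\tr (A *m B)) = \tr (A *m B).
Proof. by move=> hA hB; rewrite -mxtrace_adjmx adjmxM hA hB mxtrace_mulC. Qed.

Lemma psd_gram m n (B : 'M[C]_(m, n)) : psd (adjmx B *m B).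
Proof.
split; first by rewrite /hermitian adjmxM adjmxK.
move=> v; rewrite mulmxA -adjmxM -mulmxA mxE Re_sum.
apply: sumr_ge0 => i _; rewrite adjmxE mulrC.
by have := mulcJ_ge0 ((B *m v) i 0); rewrite lecE => /andP[].
Qed.

Lemma psd_diag_entry n (A : 'M[C]_n) i : psd A -> 0 <= Re (A i i).
Proof.
case=> _ /(_ (delta_mx i 0)).
have -> : adjmx (delta_mx i 0 : 'cV[C]_n) = delta_mx 0 i.
  by apply/matrixP => a b; rewrite adjmxE !mxE andbC conjc_nat.
by rewrite -rowE -colE !mxE.
Qed.

Lemma psd_mxtrace_ge0 n (A : 'M[C]_n) : psd A -> 0 <= Re (\tr A).
Proof. by move=> pA; rewrite Re_sum sumr_ge0 // => i _; apply: psd_diag_entry. Qed.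

Lemma psd_conj m n (A : 'M[C]_n) (B : 'M[C]_(n, m)) : psd A -> psd (adjmx B *m A *m B).
Proof.
case=> hA pA; split; first by rewrite /hermitian !adjmxM adjmxK hA mulmxA.
by move=> v; have := pA (B *m v); rewrite adjmxM !mulmxA.
Qed.

Lemma diag_mx_factor n (r : 'rV[R]_n) : (forall i, 0 <= r 0 i) ->
  exists q : 'M[C]_n, diag_mx (map_mx rc r) = adjmx q *m q.
Proof.
move=> r0; pose q := diag_mx (map_mx rc (map_mx Num.sqrt r)); exists q.
have -> : adjmx q = q.
  rewrite /adjmx tr_diag_mx map_diag_mx; congr diag_mx.
  by apply/rowP => i; rewrite !mxE /= oppr0.
rewrite mulmx_diag; congr diag_mx; apply/rowP => i; rewrite !mxE -rmorphM /=.
by rewrite -expr2 sqr_sqrtr.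
Qed.

Lemma psd_diag n (r : 'rV[R]_n) : (forall i, 0 <= r 0 i) -> psd (diag_mx (map_mx rc r)).
Proof. by move=> /diag_mx_factor[q ->]; apply: psd_gram. Qed.

(** A Hermitian matrix is normal, hence unitarily diagonalizable; its diagonal form is a unitary
    conjugate of it, so again Hermitian, with real entries. *)
Lemma hermitian_spectral n (A : 'M[C]_n) : hermitian A ->
  exists (U : 'M[C]_n) (r : 'rV[R]_n), [/\ adjmx U *m U = 1%:M, U *m adjmx U = 1%:M &
    A = adjmx U *m diag_mx (map_mx rc r) *m U].
Proof.
move=> hA.
have adjE m p (B : 'M[C]_(m, p)) : adjmx B = map_mx Num.conj B^T.
  by apply/matrixP => i j; rewrite [LHS]adjmxE conjc_conjC !mxE.
have nA : A \is normalmx by apply/normalmxP; rewrite -adjE hA.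
set U := spectralmx A.
have UU : U *m adjmx U = 1%:M by rewrite adjE; apply/unitarymxP/spectral_unitarymx.
have eA : A = adjmx U *m diag_mx (spectral_diag A) *m U.
  rewrite {1}(orthomx_spectralP nA) invmx_unitary ?spectral_unitarymx //.
have UU' : adjmx U *m U = 1%:M by apply: mulmx1C.
exists U, (map_mx Re (spectral_diag A)); split=> //.
rewrite {1}eA; congr (_ *m _ *m _).
have hD : adjmx (diag_mx (spectral_diag A)) = diag_mx (spectral_diag A).
  have -> : diag_mx (spectral_diag A) = U *m A *m adjmx U.
    by rewrite {2}eA !mulmxA UU mul1mx -mulmxA UU mulmx1.
  by rewrite !adjmxM adjmxK hA mulmxA.
congr diag_mx; apply/rowP => i; rewrite !mxE; apply: conjc_fixed_real.
by have /matrixP/(_ i i) := hD; rewrite adjmxE !mxE eqxx !mulr1n.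
Qed.

Lemma psd_spectral n (A : 'M[C]_n) : psd A ->
  exists (U : 'M[C]_n) (r : 'rV[R]_n), [/\ adjmx U *m U = 1%:M, U *m adjmx U = 1%:M,
    A = adjmx U *m diag_mx (map_mx rc r) *m U & forall i, 0 <= r 0 i].
Proof.
move=> pA; have [U [r [U1 U2 eA]]] := hermitian_spectral pA.1.
exists U, r; split=> // i.
have := psd_diag_entry i (psd_conj (adjmx U) pA).
by rewrite adjmxK eA !mulmxA U2 mul1mx -mulmxA U2 mulmx1 !mxE eqxx mulr1n.
Qed.

Lemma psd_factor n (A : 'M[C]_n) : psd A -> exists B : 'M[C]_n, A = adjmx B *m B.
Proof.
move=> /psd_spectral[U [r [_ _ -> /diag_mx_factor[q ->]]]].
by exists (q *m U); rewrite adjmxM !mulmxA.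
Qed.

(** Writing [A] as D^* D, cyclicity turns the trace into that of the psd matrix D B D^*. *)
Lemma psd_mxtraceM_ge0 n (A B : 'M[C]_n) : psd A -> psd B -> 0 <= Re (\tr (A *m B)).
Proof.
move=> /psd_factor[D ->] pB; rewrite -mulmxA mxtrace_mulC.
have := psd_mxtrace_ge0 (psd_conj (adjmx D) pB).
by rewrite adjmxK.
Qed.

Lemma psd_sqr n (A : 'M[C]_n) : hermitian A -> psd (A *m A).
Proof. by move=> hA; rewrite -{1}hA; apply: psd_gram. Qed.

(** Parallelogram law: the two sides differ by Tr (A + B)^2. *)
Lemma mxtrace_sqrB_le n (A B : 'M[C]_n) : hermitian A -> hermitian B ->
  Re (\tr ((A - B) *m (A - B))) <= 2 * Re (\tr (A *m A)) + 2 * Re (\tr (B *m B)).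
Proof.
move=> hA hB; have := psd_mxtrace_ge0 (psd_sqr (hermitianD hA hB)).
have trN := raddfN (@mxtrace C n).
rewrite !mulmxDl !mulmxDr !mulNmx !mulmxN opprK !mxtraceD !trN /= !ReD !ReN.
by lra.
Qed.

(** The eigenvalues of a state are nonnegative with sum 1, so none exceeds 1. *)
Lemma psd_state_compl n (A : 'M[C]_n) : is_state A -> psd (1%:M - A).
Proof.
case=> /psd_spectral[U [r [U1 U2 eA r0]]] trA.
have r1 : \sum_i r 0 i = 1.
  have : Re (\tr A) = 1 by rewrite trA.
  rewrite eA -mulmxA mxtrace_mulC -mulmxA U2 mulmx1 mxtrace_diag Re_sum => <-.
  by apply: eq_bigr => i _; rewrite !mxE.
have -> : 1%:M - A = adjmx U *m diag_mx (map_mx rc (const_mx 1 - r)) *m U.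
  rewrite map_mxB raddfB /= mulmxBr mulmxBl -eA; congr (_ - _).
  by rewrite map_const_mx diag_const_mx mulmx1.
apply/psd_conj/psd_diag => i; rewrite !mxE subr_ge0 -r1 (bigD1 i) //=.
by rewrite lerDl sumr_ge0.
Qed.

Lemma mxtraceM_state_le n (A B : 'M[C]_n) :
  psd A -> is_state B -> Re (\tr (A *m B)) <= Re (\tr A).
Proof.
move=> pA sB; have := psd_mxtraceM_ge0 pA (psd_state_compl sB).
by rewrite mulmxBr mulmx1 raddfB /= ReB subr_ge0.
Qed.

Lemma sqr_dist_mono (mu tau x : R) :
  (mu < tau <= x) \/ (x <= tau < mu) -> (tau - mu) ^+ 2 <= (x - mu) ^+ 2.
Proof.
move=> h; rewrite -subr_ge0.
have -> : (x - mu) ^+ 2 - (tau - mu) ^+ 2 = (x - tau) * (x + tau - 2 * mu) by ring.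
case: h => /andP[h1 h2]; first by apply: mulr_ge0; lra.
by rewrite -mulrNN; apply: mulr_ge0; lra.
Qed.

(* The effect projects onto the eigenvectors of O with eigenvalue at most tau;
   both error bounds are Chebyshev's inequality for the spectral measure. *)
Lemma threshold_effect n (O : 'M[C]_n) (tau : R) : hermitian O ->
  exists M : 'M[C]_n, is_effect M /\ forall (W : 'M[C]_n) (mu : R), is_state W ->
    let V := Re (\tr ((O - (rc mu)%:M) *m (O - (rc mu)%:M) *m W)) in
    (mu < tau -> (tau - mu) ^+ 2 * (1 - Re (\tr (M *m W))) <= V) /\
    (tau < mu -> (tau - mu) ^+ 2 * Re (\tr (M *m W)) <= V).
Proof.
move=> hO; have [U [r [U1 U2 eO]]] := hermitian_spectral hO.
(* Functional calculus of [O]: [S q] keeps the eigenvectors of [O] and has the eigenvalues [q]. *)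
pose S (q : 'rV[R]_n) : 'M[C]_n := adjmx U *m diag_mx (map_mx rc q) *m U.
have SB p q : S p - S q = S (p - q).
  by rewrite /S map_mxB raddfB /= mulmxBr mulmxBl.
have Sc a : S (const_mx a) = (rc a)%:M.
  rewrite /S map_const_mx diag_const_mx mul_mx_scalar -scalemxAl U1.
  by rewrite scalemx1.
have SM p q : S p *m S q = S (\row_i (p 0 i * q 0 i)).
  rewrite /S !mulmxA -(mulmxA _ U) U2 mulmx1 -(mulmxA (adjmx U)) mulmx_diag.
  congr (_ *m diag_mx _ *m _); apply/rowP => i; rewrite !mxE; exact/esym/rmorphM.
have SZ a q : rc a *: S q = S (a *: q).
  rewrite /S scalemxAl scalemxAr; congr (_ *m _ *m _); rewrite -linearZ /=.
  by congr diag_mx; apply/rowP => i; rewrite !mxE; exact/esym/rmorphM.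
have Spsd (q : 'rV[R]_n) : (forall i, 0 <= q 0 i) -> psd (S q).
  by move=> q0; apply/psd_conj/psd_diag.
pose m : 'rV[R]_n := \row_i (r 0 i <= tau)%R%:R.
have S1 : 1%:M = S (const_mx 1) by rewrite Sc.
exists (S m); split.
  split; first by apply: Spsd => i; rewrite mxE ler0n.
  rewrite S1 SB; apply: Spsd => i; rewrite !mxE.
  by case: (r 0 i <= tau); rewrite ?subrr ?subr0 ?ler01.
move=> W mu [pW trW] V.
have VE : V = Re (\tr (S (\row_i (r 0 i - mu) ^+ 2) *m W)).
  have OE : O - (rc mu)%:M = S (r - const_mx mu) by rewrite -SB Sc {1}eO.
  rewrite /V OE SM.
  suff -> : \row_i ((r - const_mx mu) 0 i * (r - const_mx mu) 0 i) =
    \row_i (r 0 i - mu) ^+ 2 by [].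
  by apply/rowP => i; rewrite !mxE expr2.
(* A pointwise inequality on the spectrum passes to expectations in [W]; with [q] the indicator of
   the error event this is Chebyshev's inequality. *)
have le_of (q : 'rV[R]_n) : (forall i, (tau - mu) ^+ 2 * q 0 i <= (r 0 i - mu) ^+ 2) ->
    (tau - mu) ^+ 2 * Re (\tr (S q *m W)) <= V.
  move=> hq.
  have : psd (S (\row_i (r 0 i - mu) ^+ 2 - (tau - mu) ^+ 2 *: q)).
    by apply: Spsd => i; rewrite !mxE subr_ge0.
  move=> /psd_mxtraceM_ge0 /(_ pW).
  by rewrite -SB -SZ mulmxBl raddfB /= ReB -scalemxAl mxtraceZ ReZ subr_ge0 VE.
split=> hmu.
  have -> : 1 - Re (\tr (S m *m W)) = Re (\tr (S (const_mx 1 - m) *m W)).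
    by rewrite -SB -S1 mulmxBl mul1mx raddfB /= trW ReB.
  apply: le_of => i; rewrite !mxE; case: (leP (r 0 i) tau) => h.
    by rewrite subrr mulr0 sqr_ge0.
  by rewrite subr0 mulr1 sqr_dist_mono //; left; rewrite hmu ltW.
apply: le_of => i; rewrite !mxE; case: (leP (r 0 i) tau) => h; last by rewrite mulr0 sqr_ge0.
by rewrite mulr1 sqr_dist_mono //; right; rewrite hmu h.
Qed.

End HermitianMatrices.

(** * Site operators and the swap statistic *)

Section SiteOperators.
Variables (R : realType) (d : nat) (I : finType).
Local Notation C := R[i].
Local Notation Re := (@complex.Re R).
Local Notation rc := (real_complex R).
Local Notation Mn := 'M[C]_#|{: {ffun I -> 'I_d}}|.

(** The basis is enumerated as in [prod_state], so that over ['I_(T + T)] the two agree by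
    conversion. *)
Definition tens (A : I -> 'M[C]_d) : Mn :=
  \matrix_(i, j) \prod_k A k ((enum_val i : {ffun I -> 'I_d}) k)
                              ((enum_val j : {ffun I -> 'I_d}) k).

Lemma eq_tens (A B : I -> 'M[C]_d) : A =1 B -> tens A = tens B.
Proof.
by move=> AB; apply/matrixP => i j; rewrite !mxE; apply: eq_bigr => k _; rewrite AB.
Qed.

Lemma sum_enum_val (F : {ffun I -> 'I_d} -> C) :
  \sum_(i < #|{: {ffun I -> 'I_d}}|) F (enum_val i) = \sum_f F f.
Proof.
rewrite (reindex enum_rank) /=; last by apply: onW_bij; apply: enum_rank_bij.
by apply: eq_bigr => f _; rewrite enum_rankK.
Qed.

Lemma tensM (A B : I -> 'M[C]_d) : tens A *m tens B = tens (fun k => A k *m B k).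
Proof.
apply/matrixP => i j; rewrite !mxE.
pose F k (c : 'I_d) := A k ((enum_val i : {ffun I -> 'I_d}) k) c *
  B k c ((enum_val j : {ffun I -> 'I_d}) k).
transitivity (\sum_(f : {ffun I -> 'I_d}) \prod_k F k (f k)).
  rewrite -sum_enum_val; apply: eq_bigr => k _.
  by rewrite !mxE -big_split.
by rewrite -bigA_distr_bigA; apply: eq_bigr => k _; rewrite mxE.
Qed.

Lemma mxtrace_tens (A : I -> 'M[C]_d) : \tr (tens A) = \prod_k \tr (A k).
Proof.
rewrite bigA_distr_bigA -sum_enum_val.
by apply: eq_bigr => i _; rewrite mxE.
Qed.

Lemma adjmx_tens (A : I -> 'M[C]_d) : adjmx (tens A) = tens (fun k => adjmx (A k)).
Proof.
apply/matrixP => i j; rewrite adjmxE !mxE rmorph_prod.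
by apply: eq_bigr => k _; rewrite adjmxE.
Qed.

Lemma tens1 : tens (fun=> 1%:M) = 1%:M.
Proof.
apply/matrixP => i j; rewrite !mxE.
have [->|nij] := eqVneq i j; first by rewrite big1 // => k _; rewrite mxE eqxx.
have [k nk] : exists k, (enum_val i : {ffun I -> 'I_d}) k != enum_val j k.
  apply/existsP; rewrite -negb_forall; apply: contra nij => /forallP h.
  by apply/eqP/enum_val_inj/ffunP => k; apply/eqP.
by rewrite (bigD1 k) //= mxE (negPf nk) mul0r.
Qed.

Lemma tens_state (w : I -> 'M[C]_d) : (forall k, is_state (w k)) -> is_state (tens w).
Proof.
move=> sw; split; last by rewrite mxtrace_tens big1 // => k _; case: (sw k).
have [B wB] := fin_all_exists (fun k => psd_factor (sw k).1).
have -> : tens w = adjmx (tens B) *m tens B.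
  by rewrite adjmx_tens tensM; apply: eq_tens.
exact: psd_gram.
Qed.

Definition site (k : I) (A : 'M[C]_d) : Mn :=
  tens (fun m => if m == k then A else 1%:M).

Lemma site_is_linear k : linear (site k).
Proof.
move=> a A B; apply/matrixP => i j; rewrite !mxE.
rewrite !(bigD1 (P := predT) k) //= !eqxx !mxE mulrDl mulrA.
by congr (_ * _ + _ * _); apply: eq_bigr => m /negPf->.
Qed.
HB.instance Definition _ k :=
  GRing.isLinear.Build C 'M[C]_d Mn *:%R (site k) (site_is_linear k).

Lemma siteM k A B : site k A *m site k B = site k (A *m B).
Proof. by rewrite tensM; apply: eq_tens => m; case: eqP; rewrite ?mulmx1. Qed.

Lemma site1 k : site k 1%:M = 1%:M.
Proof. by rewrite -tens1; apply: eq_tens => m; case: eqP. Qed.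

Lemma site_scalar k a : site k a%:M = a%:M.
Proof. by rewrite -scalemx1 linearZ /= site1 scalemx1. Qed.

Lemma siteC k l A B : k != l -> site k A *m site l B = site l B *m site k A.
Proof.
move=> kl; rewrite !tensM; apply: eq_tens => m.
by case: eqP => [->|_]; rewrite ?(negPf kl) ?mulmx1 ?mul1mx.
Qed.

Lemma adjmx_site k A : adjmx (site k A) = site k (adjmx A).
Proof.
by rewrite adjmx_tens; apply: eq_tens => m; case: eqP; rewrite ?adjmx_scalar ?conjc1.
Qed.

(** The exchange of two tensor factors, expanded in matrix units so that each factor can be centered
    separately. For k = l the sum is the scalar d instead. *)
Definition swap (k l : I) : Mn :=
  \sum_a \sum_b site k (delta_mx a b) *m site l (delta_mx b a).

Lemma adjmx_delta (a b : 'I_d) : adjmx (delta_mx a b : 'M[C]_d) = delta_mx b a.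
Proof. by apply/matrixP => i j; rewrite adjmxE !mxE andbC conjc_nat. Qed.

Lemma hermitian_swap k l : k != l -> hermitian (swap k l).
Proof.
move=> kl; rewrite /hermitian /swap [RHS]exchange_big /= adjmx_sum; apply: eq_bigr => a _.
rewrite adjmx_sum; apply: eq_bigr => b _.
by rewrite adjmxM !adjmx_site !adjmx_delta siteC // eq_sym.
Qed.

Lemma swap_involutive k l : k != l -> swap k l *m swap k l = 1%:M.
Proof.
move=> kl; rewrite mulmx_suml.
transitivity (\sum_a \sum_b site k (delta_mx a a) *m site l (delta_mx b b)); last first.
  have S m : \sum_a site m (delta_mx a a) = 1%:M.
    by rewrite -(linear_sum (site m)) -mx1_sum_delta /= site1.
  by rewrite -[RHS]mulmx1 -{1}(S k) -(S l) mulmx_suml; apply: eq_bigr => a _; rewrite mulmx_sumr.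
apply: eq_bigr => a _; rewrite mulmx_suml; apply: eq_bigr => b _.
(* A product of two terms survives only for c = b and e = a, where it is E_aa at [k] times E_bb at
   [l]. *)
have E c e : site k (delta_mx a b) *m site l (delta_mx b a) *m
    (site k (delta_mx c e) *m site l (delta_mx e c)) =
    (site k (delta_mx a a) *m site l (delta_mx b b)) *+ ((c == b) && (e == a)).
  rewrite mulmxA -(mulmxA (site k _)) -siteC // mulmxA siteM -mulmxA siteM.
  rewrite !mul_delta_mx_cond (eq_sym b c) (eq_sym a e).
  by case: eqP => [->|_]; case: eqP => [->|_] //=; rewrite ?mulr0n ?raddf0 ?mulmx0 ?mul0mx.
rewrite mulmx_sumr (bigD1 b) //= mulmx_sumr (bigD1 a) //= E !eqxx /= mulr1n.
rewrite big1 ?addr0; last by move=> e ea; rewrite E (negPf ea) andbF.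
rewrite big1 ?addr0 // => c cb; rewrite mulmx_sumr big1 // => e _.
by rewrite E (negPf cb).
Qed.

(** * Expectations in a product state *)

Section Expectation.
Variable w : I -> 'M[C]_d.
Hypothesis w_state : forall k, is_state (w k).

Definition Ex (A : Mn) : C := \tr (A *m tens w).

Lemma Ex_is_scalar : scalar Ex.
Proof. by move=> a A B; rewrite /Ex mulmxDl -scalemxAl raddfD /= mxtraceZ. Qed.
HB.instance Definition _ :=
  GRing.isLinear.Build C Mn C *%R Ex Ex_is_scalar.

Lemma ExZ a A : Ex (a *: A) = a * Ex A.
Proof. exact: linearZ. Qed.

Lemma Ex_sum (J : Type) (r : seq J) (P : pred J) (F : J -> Mn) :
  Ex (\sum_(j <- r | P j) F j) = \sum_(j <- r | P j) Ex (F j).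
Proof. exact: linear_sum. Qed.

Lemma mxtrace_w k : \tr (w k) = 1. Proof. by case: (w_state k). Qed.
Lemma hermitian_w k : hermitian (w k). Proof. by case: (w_state k) => -[]. Qed.

Lemma Ex_tens A : Ex (tens A) = \prod_k \tr (A k *m w k).
Proof. by rewrite /Ex tensM mxtrace_tens. Qed.

(** Expectations factor over the sites, so one centered factor kills the product. All orthogonality
    relations below reduce to this. *)
Lemma Ex_tens_centered k A : \tr (A k *m w k) = 0 -> Ex (tens A) = 0.
Proof. by move=> h; rewrite Ex_tens (bigD1 k) //= h mul0r. Qed.

Lemma Ex_site k A : Ex (site k A) = \tr (A *m w k).
Proof.
rewrite Ex_tens (bigD1 k) //= eqxx big1 ?mulr1 // => l /negPf->.
by rewrite mul1mx mxtrace_w.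
Qed.

Lemma Ex1 : Ex 1%:M = 1.
Proof. by rewrite -tens1 Ex_tens big1 // => k _; rewrite mul1mx mxtrace_w. Qed.

Lemma Ex_sqr_ge0 A : hermitian A -> 0 <= Re (Ex (A *m A)).
Proof.
move=> hA; apply: psd_mxtraceM_ge0; first exact: psd_sqr.
exact: (tens_state w_state).1.
Qed.

(** The two sides differ by the expectation of (A - B)^2. *)
Lemma Ex_sqrD_le A B : hermitian A -> hermitian B ->
  Re (Ex ((A + B) *m (A + B))) <= 2 * Re (Ex (A *m A)) + 2 * Re (Ex (B *m B)).
Proof.
move=> hA hB; have := Ex_sqr_ge0 (hermitianB hA hB).
have ExD := linearD Ex; have ExN := linearN Ex.
rewrite !mulmxDl !mulmxDr !mulNmx !mulmxN opprK !ExD !ExN /= !ReD !ReN.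
by lra.
Qed.

(** The matrix unit minus its expectation in [w k], which is the transposed entry. *)
Definition cdelta k a b : 'M[C]_d := delta_mx a b - (w k b a)%:M.

Lemma mxtrace_delta_mul a b (A : 'M[C]_d) : \tr (delta_mx a b *m A) = A b a.
Proof.
rewrite /mxtrace (bigD1 a) //= mxE (bigD1 b) //= mxE !eqxx mul1r.
rewrite big1 ?addr0; last by move=> c /negPf cb; rewrite mxE cb andbF mul0r.
rewrite big1 ?addr0 // => c /negPf ca; rewrite mxE big1 // => e _.
by rewrite mxE ca mul0r.
Qed.

Lemma mxtrace_cdelta k a b : \tr (cdelta k a b *m w k) = 0.
Proof.
by rewrite mulmxBl raddfB /= mxtrace_delta_mul mul_scalar_mx mxtraceZ mxtrace_w mulr1 subrr.
Qed.

(* Doubly centered part of the swap: the degenerate term of its Hoeffding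
   decomposition. *)
Definition cswap k l : Mn :=
  \sum_a \sum_b site k (cdelta k a b) *m site l (cdelta l b a).

(** In each term of the swap, write both matrix units as centered part plus mean. The terms with one
    mean resum to [w l] at site [k] and [w k] at site [l], those with two means to the trace. *)
Lemma swap_hoeffding k l :
  swap k l = cswap k l + (site k (w l) + site l (w k) - (\tr (w k *m w l))%:M).
Proof.
have wE m : w m = \sum_a \sum_b w m a b *: delta_mx a b by exact: matrix_sum_delta.
have E1 : site k (w l) = \sum_a \sum_b w l a b *: site k (delta_mx a b).
  rewrite {1}wE linear_sum; apply: eq_bigr => a _; rewrite linear_sum.
  by apply: eq_bigr => b _; rewrite linearZ.
have E2 : site l (w k) = \sum_a \sum_b w k b a *: site l (delta_mx b a).
  rewrite {1}wE exchange_big /= linear_sum; apply: eq_bigr => a _; rewrite linear_sum.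
  by apply: eq_bigr => b _; rewrite linearZ.
have E3 : (\tr (w k *m w l))%:M = \sum_a \sum_b (w k b a * w l a b)%:M :> Mn.
  rewrite /mxtrace exchange_big /= raddf_sum; apply: eq_bigr => a _.
  by rewrite mxE raddf_sum.
rewrite E1 E2 E3 -!big_split -sumrN -!big_split; apply: eq_bigr => a _ /=.
rewrite -!big_split -sumrN -!big_split; apply: eq_bigr => b _ /=.
rewrite /cdelta (linearB (site k)) (linearB (site l)) /= !site_scalar.
rewrite mulmxBl !mulmxBr !mul_mx_scalar !mul_scalar_mx.
have zmodE (V : zmodType) (p x y z : V) : p = p - x - (y - z) + (x + y - z).
  by rewrite -[p - x - _]addrA -opprD -[x + y - z]addrA subrK.
by rewrite scale_scalar_mx (mulrC (w l a b)) -zmodE.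
Qed.

Lemma cswapC k l : k != l -> cswap k l = cswap l k.
Proof.
move=> kl; rewrite /cswap exchange_big; apply: eq_bigr => a _; apply: eq_bigr => b _.
by rewrite siteC.
Qed.

(** The site operator meets only one leg of [cswap k l]; the other leg is alone at its site and
    centered. *)
Lemma Ex_cswap_site k l m A : k != l -> m = k \/ m = l ->
  Ex (cswap k l *m site m A) = 0 /\ Ex (site m A *m cswap k l) = 0.
Proof.
move=> kl mkl; rewrite /cswap mulmx_suml mulmx_sumr !linear_sum.
split; apply: big1 => a _; rewrite ?mulmx_suml ?mulmx_sumr linear_sum;
  apply: big1 => b _; rewrite !tensM.
- case: mkl => ->; [apply: (Ex_tens_centered (k := l)) | apply: (Ex_tens_centered (k := k))].
  + by rewrite eqxx eq_sym (negPf kl) mul1mx mulmx1 mxtrace_cdelta.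
  + by rewrite eqxx (negPf kl) !mulmx1 mxtrace_cdelta.
- case: mkl => ->; [apply: (Ex_tens_centered (k := l)) | apply: (Ex_tens_centered (k := k))].
  + by rewrite eqxx eq_sym (negPf kl) !mul1mx mxtrace_cdelta.
  + by rewrite eqxx (negPf kl) mul1mx mulmx1 mxtrace_cdelta.
Qed.

(** One of [k], [l] is missed by the second factor, so the centered leg there stands alone. *)
Lemma Ex_cswap_orthogonal k l i j : k != l ->
  ~~ ((k \in [:: i; j]) && (l \in [:: i; j])) -> Ex (cswap k l *m cswap i j) = 0.
Proof.
rewrite !inE negb_and !negb_or => kl h.
rewrite /cswap mulmx_suml linear_sum; apply: big1 => a _.
rewrite mulmx_suml linear_sum; apply: big1 => b _.
rewrite mulmx_sumr linear_sum; apply: big1 => c _.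
rewrite mulmx_sumr linear_sum; apply: big1 => e _; rewrite !tensM.
case/orP: h => /andP[/negPf h1 /negPf h2].
  apply: (Ex_tens_centered (k := k)).
  by rewrite eqxx (negPf kl) h1 h2 !mulmx1 mxtrace_cdelta.
apply: (Ex_tens_centered (k := l)).
by rewrite eqxx eq_sym (negPf kl) h1 h2 mul1mx !mulmx1 mxtrace_cdelta.
Qed.

(* Pythagoras: the centered part of the swap is orthogonal to the rest, and the
   swap squares to the identity. *)
Lemma Ex_cswap_sqr_le1 k l : k != l -> Re (Ex (cswap k l *m cswap k l)) <= 1.
Proof.
move=> kl; pose r := site k (w l) + site l (w k) - (\tr (w k *m w l))%:M.
have hr : hermitian r.
  apply: hermitianB; first apply: hermitianD.
  - by rewrite /hermitian adjmx_site hermitian_w.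
  - by rewrite /hermitian adjmx_site hermitian_w.
  - by apply/hermitian_scalar/conjc_mxtraceM; apply: hermitian_w.
have [c1 c2] := Ex_cswap_site (w l) kl (or_introl erefl).
have [c3 c4] := Ex_cswap_site (w k) kl (or_intror erefl).
have [c5 c6] := Ex_cswap_site (\tr (w k *m w l))%:M kl (or_introl erefl).
rewrite site_scalar in c5 c6.
have r1 : Ex (cswap k l *m r) = 0.
  by rewrite mulmxBr mulmxDr linearB linearD /= c1 c3 c5 addr0 subr0.
have r2 : Ex (r *m cswap k l) = 0.
  by rewrite mulmxBl mulmxDl linearB linearD /= c2 c4 c6 addr0 subr0.
have : Re (Ex (swap k l *m swap k l)) = 1 by rewrite swap_involutive // Ex1.
have -> : swap k l = cswap k l + r by exact: swap_hoeffding.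
move: r hr r1 r2 => r hr r1 r2.
rewrite mulmxDl !mulmxDr !(linearD Ex) /= r1 r2 addr0 add0r ReD => <-.
by rewrite lerDl Ex_sqr_ge0.
Qed.

(** * Mean and variance of the swap statistic *)

Section Statistic.
Variable s : I -> C.
Hypothesis s_sqr : forall k, s k * s k = 1.
Hypothesis s_real : forall k, conjc (s k) = s k.

Let pair_sign (p : I * I) := s p.1 * s p.2.

Definition swap_stat : Mn := \sum_(p : I * I | p.1 != p.2) pair_sign p *: swap p.1 p.2.

Definition wsum : 'M[C]_d := \sum_k s k *: w k.

Lemma hermitian_wsum : hermitian wsum.
Proof. by apply: hermitian_sum => k _; apply: hermitianZ => //; apply: hermitian_w. Qed.

Lemma pair_sign_real p : conjc (pair_sign p) = pair_sign p.
Proof. by rewrite rmorphM /= !s_real. Qed.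

Lemma hermitian_swap_stat : hermitian swap_stat.
Proof.
apply: hermitian_sum => p hp; apply: hermitianZ; first exact: pair_sign_real.
exact: hermitian_swap.
Qed.

(** The signed sum of the states away from [k], by [othersE]. As a difference from [wsum] it can be
    bounded through Tr wsum^2. *)
Let others k := wsum - s k *: w k.
Let cothers k := others k - (\tr (others k *m w k))%:M.

Lemma othersE k : others k = \sum_(l | k != l) s l *: w l.
Proof.
rewrite /others /wsum (bigD1 k) //= addrAC subrr add0r.
by apply: eq_bigl => l; rewrite eq_sym.
Qed.

Definition stat_mean : C := \tr (wsum *m wsum) - \sum_k \tr (w k *m w k).

(** Since each sign squares to 1, the subtracted traces are exactly the diagonal terms of the
    expanded Tr wsum^2. *)
Lemma stat_meanE :
  stat_mean = \sum_(p : I * I | p.1 != p.2) pair_sign p * \tr (w p.1 *m w p.2).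
Proof.
rewrite -(pair_big_dep predT (fun k l => k != l)
  (fun k l => pair_sign (k, l) * \tr (w k *m w l))) /=.
rewrite /stat_mean {1}/wsum mulmx_suml raddf_sum -sumrB; apply: eq_bigr => k _ /=.
have -> : \tr (w k *m w k) = \tr (s k *: w k *m (s k *: w k)).
  by rewrite -scalemxAl -scalemxAr scalerA s_sqr scale1r.
rewrite -raddfB /= -mulmxBr -/(others k) othersE mulmx_sumr raddf_sum; apply: eq_bigr => l _ /=.
by rewrite -scalemxAl -scalemxAr scalerA mxtraceZ.
Qed.

(** The factor 2 arises because each site occurs both as first and as second entry of ordered
    pairs. *)
Definition stat_lin : Mn := \sum_k (2 * s k) *: site k (cothers k).
Definition stat_quad : Mn := \sum_(p : I * I | p.1 != p.2) pair_sign p *: cswap p.1 p.2.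

(** Sum [swap_hoeffding] over ordered pairs. The two linear terms [H k l] and [H l k] have equal
    signed sums, by reversing the pairs. *)
Lemma swap_stat_hoeffding : swap_stat - stat_mean%:M = stat_quad + stat_lin.
Proof.
pose H k l := site k (w l) - (\tr (w k *m w l))%:M.
have linE : \sum_(p : I * I | p.1 != p.2) pair_sign p *: H p.1 p.2 =
    \sum_k s k *: site k (cothers k).
  rewrite -(pair_big_dep predT (fun k l => k != l) (fun k l => pair_sign (k, l) *: H k l)) /=.
  apply: eq_bigr => k _; rewrite /cothers [in RHS](linearB (site k)) /= site_scalar.
  have -> : site k (others k) = \sum_(l | k != l) s l *: site k (w l).
    by rewrite othersE linear_sum; apply: eq_bigr => l _; rewrite linearZ.
  have -> : (\tr (others k *m w k))%:M = \sum_(l | k != l) s l *: (\tr (w k *m w l))%:M :> Mn.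
    rewrite othersE mulmx_suml (linear_sum (@mxtrace C d)) /= (raddf_sum (@scalar_mx C _)).
    apply: eq_bigr => l _ /=.
    by rewrite -scalemxAl mxtraceZ mxtrace_mulC scale_scalar_mx.
  rewrite -sumrB scaler_sumr; apply: eq_bigr => l _.
  by rewrite /pair_sign /= -scalerA -scalerBr.
have linE' : \sum_(p : I * I | p.1 != p.2) pair_sign p *: H p.2 p.1 =
    \sum_k s k *: site k (cothers k).
  have inj : injective (fun p : I * I => (p.2, p.1)) by move=> [a b] [c e] [-> ->].
  rewrite -[RHS]linE [LHS](reindex_inj inj) /=.
  by apply: eq_big => p; rewrite eq_sym // /pair_sign mulrC.
have -> : stat_lin = \sum_k s k *: site k (cothers k) + \sum_k s k *: site k (cothers k).
  by rewrite -big_split; apply: eq_bigr => k _; rewrite /= -scalerDl mulr_natl mulr2n.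
rewrite -{1}linE -linE' -!big_split stat_meanE raddf_sum -sumrB; apply: eq_bigr => p _ /=.
rewrite -scale_scalar_mx -scalerBr -!scalerDr; congr (_ *: _).
rewrite swap_hoeffding /H (mxtrace_mulC (w p.2)) -addrA; congr (_ + _).
by rewrite -!addrA; congr (_ + _); rewrite addrCA.
Qed.

(** Against a pair p only p itself and its reversal correlate. Each contributes at most 1, and there
    are at most [#|I| ^ 2] ordered pairs. *)
Lemma Ex_stat_quad_sqr : Re (Ex (stat_quad *m stat_quad)) <= 2 * (#|I| ^ 2)%:R.
Proof.
have sign2 p : pair_sign p * pair_sign p = 1 by rewrite /pair_sign mulrACA !s_sqr mulr1.
rewrite {1}/stat_quad mulmx_suml Ex_sum Re_sum.
apply: (@le_trans _ _ (\sum_(p : I * I | p.1 != p.2) 2%:R)).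
  apply: ler_sum => p hp.
  rewrite -scalemxAl ExZ mulmx_sumr Ex_sum.
  rewrite (bigD1 p) //= (bigD1 (p.2, p.1)) /=; last first.
    rewrite eq_sym hp /=; apply: contra hp => /eqP e.
    by rewrite -{1}e /=.
  rewrite big1 => [|q /andP[/andP[hq qp] qp']]; last first.
    rewrite -scalemxAr ExZ Ex_cswap_orthogonal ?mulr0 //.
    apply/negP => /andP[]; rewrite !inE.
    case: p q hp hq qp qp' => [k l] [i j] /= hp hq.
    rewrite !xpair_eqE => qp qp' /orP[]/eqP ? /orP[]/eqP ?; subst.
    - by rewrite eqxx in hp.
    - by rewrite !eqxx in qp.
    - by rewrite !eqxx in qp'.
    - by rewrite eqxx in hp.
  have signC : pair_sign (p.2, p.1) = pair_sign p by rewrite /pair_sign mulrC.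
  have alg (c x : C) : c * c = 1 -> c * (c * x + (c * x + 0)) = x + x.
    by move=> h; rewrite addr0 -mulrDr mulrA h mul1r.
  rewrite signC -(cswapC hp) -!scalemxAr !ExZ alg // ReD.
  have := Ex_cswap_sqr_le1 hp; lra.
rewrite sumr_const -[leLHS]mulr_natr ler_wpM2l ?ler0n // ler_nat.
by rewrite (leq_trans (max_card _)) // card_prod mulnn.
Qed.

Lemma hermitian_others k : hermitian (others k).
Proof.
apply: hermitianB; first exact: hermitian_wsum.
by apply: hermitianZ => //; apply: hermitian_w.
Qed.

Lemma hermitian_cothers k : hermitian (cothers k).
Proof.
apply: hermitianB; first exact: hermitian_others.
apply/hermitian_scalar/conjc_mxtraceM; [exact: hermitian_others | exact: hermitian_w].
Qed.

Lemma mxtrace_cothers k : \tr (cothers k *m w k) = 0.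
Proof. by rewrite /cothers mulmxBl raddfB /= mul_scalar_mx mxtraceZ mxtrace_w mulr1 subrr. Qed.

(** A variance is at most the second moment, which in a state is at most Tr (others k)^2. The
    parallelogram bound then separates [wsum] from [w k], whose purity is at most 1. *)
Lemma cothers_sqr_le k :
  Re (\tr (cothers k *m cothers k *m w k)) <= 2 * Re (\tr (wsum *m wsum)) + 2.
Proof.
have hD := hermitian_others k.
apply: (@le_trans _ _ (Re (\tr (others k *m others k *m w k)))).
  set h := \tr (others k *m w k).
  have hE : h = rc (Re h) by apply/conjc_fixed_real/conjc_mxtraceM => //; apply: hermitian_w.
  have -> : \tr (cothers k *m cothers k *m w k) = \tr (others k *m others k *m w k) - h * h.
    by apply: mxtrace_centered_sqr; apply: mxtrace_w.
  by rewrite ReB gerBl hE ReZ /= -expr2 sqr_ge0.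
apply: le_trans (mxtraceM_state_le (psd_sqr hD) (w_state k)) _.
set b := s k *: w k.
have hb : hermitian b by apply: hermitianZ => //; apply: hermitian_w.
have bb : Re (\tr (b *m b)) <= 1.
  rewrite /b -scalemxAl -scalemxAr scalerA s_sqr scale1r.
  apply: le_trans (mxtraceM_state_le (w_state k).1 (w_state k)) _.
  by rewrite mxtrace_w.
have := mxtrace_sqrB_le hermitian_wsum hb.
rewrite -/(others k).
by lra.
Qed.

(** Centered operators at distinct sites are uncorrelated, so only the diagonal terms remain, each
    with coefficient (2 s_k)^2 = 4. *)
Lemma Ex_stat_lin_sqr :
  Re (Ex (stat_lin *m stat_lin)) <= #|I|%:R * (8 * Re (\tr (wsum *m wsum)) + 8).
Proof.
rewrite {1}/stat_lin mulmx_suml Ex_sum Re_sum mulr_natl -sumr_const.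
apply: ler_sum => k _.
rewrite -scalemxAl ExZ mulmx_sumr Ex_sum (bigD1 k) //= big1 ?addr0; last first.
  move=> l lk; rewrite -scalemxAr ExZ tensM (Ex_tens_centered (k := k)) ?mulr0 //.
  by rewrite eqxx eq_sym (negPf lk) mulmx1 mxtrace_cothers.
rewrite -scalemxAr ExZ siteM Ex_site mulrA.
have -> : 2 * s k * (2 * s k) = rc 4 by rewrite mulrACA s_sqr mulr1 -natrM rmorph_nat.
by rewrite ReZ; have := cothers_sqr_le k; lra.
Qed.

Lemma hermitian_stat_lin : hermitian stat_lin.
Proof.
apply: hermitian_sum => k _; apply: hermitianZ; first by rewrite rmorphM rmorph_nat /= s_real.
by rewrite /hermitian adjmx_site hermitian_cothers.
Qed.

Lemma stat_mean_real : conjc stat_mean = stat_mean.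
Proof.
rewrite rmorphB /= (conjc_mxtraceM hermitian_wsum hermitian_wsum) rmorph_sum.
by congr (_ - _); apply: eq_bigr => k _; apply: conjc_mxtraceM; apply: hermitian_w.
Qed.

Lemma swap_stat_variance :
  let V := swap_stat - stat_mean%:M in
  Re (Ex (V *m V)) <=
    4 * #|I|%:R ^+ 2 + 16 * #|I|%:R * (Re (\tr (wsum *m wsum)) + 1).
Proof.
rewrite /= swap_stat_hoeffding.
(* Self-adjointness comes by difference: the centered statistic minus its linear part. *)
have hQ : hermitian stat_quad.
  rewrite -[stat_quad](addrK stat_lin) -swap_stat_hoeffding.
  apply/hermitianB/hermitian_stat_lin/hermitianB; first exact: hermitian_swap_stat.
  exact/hermitian_scalar/stat_mean_real.
have := Ex_sqrD_le hQ hermitian_stat_lin.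
by have := Ex_stat_quad_sqr; have := Ex_stat_lin_sqr; rewrite natrX; lra.
Qed.

End Statistic.
End Expectation.
End SiteOperators.

(** * The testers *)

Section Testing.
Variable R : realType.
Local Notation C := R[i].
Local Notation Re := (@complex.Re R).
Local Notation rc := (real_complex R).

Definition sign_of T (k : 'I_(T + T)) : C :=
  match split k with inl _ => 1 | inr _ => -1 end.

Definition joint_family d T (rho sigma : 'I_T -> 'M[C]_d) (k : 'I_(T + T)) :=
  match split k with inl t => rho t | inr t => sigma t end.

Lemma sign_of_sqr T (k : 'I_(T + T)) : sign_of k * sign_of k = 1.
Proof. by rewrite /sign_of; case: split => _; rewrite ?mulrNN mulr1. Qed.

Lemma sign_of_real T (k : 'I_(T + T)) : conjc (sign_of k) = sign_of k.
Proof. by rewrite /sign_of; case: split => _; rewrite ?rmorphN /= ?oppr0. Qed.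

Lemma wsum_avg d T (rho sigma : 'I_T -> 'M[C]_d) : (0 < T)%N ->
  wsum (joint_family rho sigma) (@sign_of T) =
  T%:R *: (avg_state rho - avg_state sigma).
Proof.
move=> T0; have T1 : T%:R != 0 :> C by rewrite pnatr_eq0 -lt0n.
rewrite /avg_state -scalerBr scalerA mulfV // scale1r /wsum big_split_ord /= -sumrN.
congr (_ + _); apply: eq_bigr => t _; rewrite /sign_of /joint_family.
  by rewrite (unsplitK (inl t)) scale1r.
by rewrite (unsplitK (inr t)) scaleN1r.
Qed.

Lemma mxtrace_wsum_sqr d T (rho sigma : 'I_T -> 'M[C]_d) : (0 < T)%N ->
  let D := wsum (joint_family rho sigma) (@sign_of T) in
  Re (\tr (D *m D)) = T%:R ^+ 2 * DHS2 (avg_state rho) (avg_state sigma).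
Proof.
move=> T0 /=; rewrite wsum_avg // -scalemxAl -scalemxAr scalerA mxtraceZ /DHS2 -ReZ.
by rewrite -natrM rmorphXn /= rmorph_nat natrM expr2.
Qed.

(** Chebyshev's bound made numerical: [g] is the gap between mean and threshold, [c] a lower bound
    for it, [x] the error probability. *)
Lemma error_le (g c x V : R) : 0 < c -> c <= g -> g ^+ 2 * x <= V ->
  100 * V <= c ^+ 2 -> x <= 1 / 100.
Proof.
move=> c0 cg gx Vc; rewrite leNgt; apply/negP => x1.
have : c ^+ 2 <= g ^+ 2 by rewrite ler_pXn2r ?nnegrE //; lra.
have : 0 < c ^+ 2 by rewrite exprn_gt0.
move: (c ^+ 2) (g ^+ 2) Vc gx => a b Vc gx a0 ab.
have : b * (1 / 100) < b * x by rewrite ltr_pM2l //; lra.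
lra.
Qed.

(** Here [n] is T, with 2n sites, [P] is T^2 D_HS^2 and [m] the scale of the gap. The variance is at
    most 80 n m, and n m <= m^2 / 10^9, so 100 V is at most 8 m^2 / 10^6, half of the right-hand
    side. *)
Lemma variance_le (n m P V : R) : 1 <= n -> 1000 * (1000 * 1000) * n <= m -> P <= m ->
  V <= 4 * (2 * n) ^+ 2 + 16 * (2 * n) * (P + 1) -> 100 * V <= (4 / 1000 * m) ^+ 2.
Proof.
move=> n1 nm Pm hV.
have h1 : n * n <= n * m by rewrite ler_pM2l; lra.
have h2 : n * P <= n * m by rewrite ler_pM2l; lra.
have h3 : n * 1 <= n * n by rewrite ler_pM2l; lra.
have h4 : 1000 * (1000 * 1000) * n * m <= m * m by rewrite ler_pM2r; lra.
have -> : (4 / 1000 * m) ^+ 2 = 16 / (1000 * 1000) * (m * m) by field.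
have E : 4 * (2 * n) ^+ 2 + 16 * (2 * n) * (P + 1) = 16 * (n * n) + 32 * (n * P) + 32 * n.
  by ring.
rewrite {}E in hV; rewrite -mulrA in h4.
move: (n * n) (n * m) (n * P) (m * m) h1 h2 h3 h4 hV => a b c e.
lra.
Qed.

(** The mean is [P - b] with [b] the sum of the purities, and [x] is the acceptance probability. *)
Lemma threshold_decision (n theta D b V x : R) :
  let P := n ^+ 2 * D in let tau := 995 / 1000 * (n ^+ 2 * theta) in
  1 <= n -> 1000 * (1000 * 1000) <= n * theta -> 0 <= b -> b <= 2 * n ->
  V <= 4 * (2 * n) ^+ 2 + 16 * (2 * n) * (P + 1) ->
  (P - b < tau -> (tau - (P - b)) ^+ 2 * (1 - x) <= V) ->
  (tau < P - b -> (tau - (P - b)) ^+ 2 * x <= V) ->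
  (D <= 99 / 100 * theta -> 99 / 100 <= x) /\ (theta < D -> x <= 1 / 100).
Proof.
move=> P tau n1 hT b0 bn hV hlow hhigh.
have n20 : 0 < n ^+ 2 by rewrite exprn_gt0 // (lt_le_trans ltr01).
have nq : 1000 * (1000 * 1000) * n <= n ^+ 2 * theta.
  by rewrite (_ : n ^+ 2 * theta = n * theta * n) ?ler_pM2r //; [lra | ring].
have low : D <= 99 / 100 * theta -> P <= 99 / 100 * (n ^+ 2 * theta).
  by move=> h; rewrite /P mulrCA ler_pM2l.
have high : theta < D -> n ^+ 2 * theta < P by move=> h; rewrite /P ltr_pM2l.
move: P (n ^+ 2 * theta) @tau hV hlow hhigh low high nq => P q /= hV hlow hhigh low high nq.
split=> [/low hP|/high hP].
  (* Subtracting [b] only widens the gap, which is at least 0.005 q. *)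
  have [h1 h2 h3 h4] : [/\ P - b < 995 / 1000 * q, 0 < 4 / 1000 * q, P <= q &
      4 / 1000 * q <= 995 / 1000 * q - (P - b)].
    by clear -n1 b0 bn nq hP; split; lra.
  have x1 : 1 - x <= 1 / 100.
    by apply: error_le h2 h4 (hlow h1) _; apply: variance_le n1 nq h3 hV.
  by clear -x1; lra.
(* The scale is now [P], since the variance grows with it. The gap is at least 0.005 P - 2n, and 2n
   is negligible against P. *)
have [h1 h2 h3 h4] : [/\ 995 / 1000 * q < P - b, 0 < 4 / 1000 * P,
    1000 * (1000 * 1000) * n <= P & 4 / 1000 * P <= - (995 / 1000 * q - (P - b))].
  by clear -n1 b0 bn nq hP; split; lra.
apply: (error_le h2 h4 (V := V)); first by rewrite sqrrN; exact: hhigh.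
exact: variance_le n1 h3 (lexx _) hV.
Qed.

Lemma hs_tester d T (theta : R) : 1000 * (1000 * 1000) <= T%:R * theta ->
  exists M : 'M[C]_(prod_dim d T), is_effect M /\
    forall rho sigma : 'I_T -> 'M[C]_d,
      (forall t, is_state (rho t)) -> (forall t, is_state (sigma t)) ->
      (DHS2 (avg_state rho) (avg_state sigma) <= 99 / 100 * theta ->
         99 / 100 <= accept_prob M rho sigma) /\
      (theta < DHS2 (avg_state rho) (avg_state sigma) ->
         accept_prob M rho sigma <= 1 / 100).
Proof.
move=> hT.
have T0 : (0 < T)%N.
  by case: T hT => // hT; exfalso; move: hT; rewrite mul0r; lra.
have n1 : 1 <= T%:R :> R by rewrite ler1n.
set n : R := T%:R in hT n1 *.
have hO := hermitian_swap_stat d (@sign_of_real T).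
(* The effect is fixed before the states are introduced; the threshold is midway between 0.99 and 1
   times theta T^2. *)
have [M [effM hM]] := threshold_effect (995 / 1000 * (n ^+ 2 * theta)) hO.
exists M; split=> // rho sigma srho ssigma.
pose w := joint_family rho sigma.
have sw k : is_state (w k) by rewrite /w /joint_family; case: split.
pose mean := stat_mean w (@sign_of T).
have meanE : mean = rc (Re mean).
  by apply/conjc_fixed_real/stat_mean_real => //; exact: sign_of_real.
have := hM (tens w) (Re mean) (tens_state sw); rewrite -meanE /=.
have := swap_stat_variance sw (@sign_of_sqr T) (@sign_of_real T).
rewrite /= -/mean mxtrace_wsum_sqr // -/n card_ord natrD -/n.
have -> : Re (\tr (M *m tens w)) = accept_prob M rho sigma by [].
rewrite /Ex; set V := complex.Re _; set P := _ * DHS2 _ _ => hV.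
have V_le : V <= 4 * (2 * n) ^+ 2 + 16 * (2 * n) * (P + 1).
  by move: hV; rewrite (_ : n + n = 2 * n) //; ring.
have [b [b0 bn mE]] : exists b : R, [/\ 0 <= b, b <= 2 * n & Re mean = P - b].
  exists (\sum_k Re (\tr (w k *m w k))); split.
  - by apply: sumr_ge0 => k _; apply/psd_mxtrace_ge0/psd_sqr/hermitian_w.
  - have -> : 2 * n = \sum_(k < T + T) 1 by rewrite sumr_const card_ord natrD /n; ring.
    apply: ler_sum => k _.
    apply: le_trans (mxtraceM_state_le (sw k).1 (sw k)) _.
    by rewrite mxtrace_w.
  - by rewrite /mean /stat_mean ReB (mxtrace_wsum_sqr rho sigma T0) Re_sum.
by rewrite mE => -[hlow hhigh]; apply: threshold_decision n1 hT b0 bn V_le hlow hhigh.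
Qed.

(** Cauchy-Schwarz, (Tr S)^2 <= d Tr S^2 for S = |A|, read as nonnegativity of the variance of S in
    the maximally mixed state [B]. *)
Lemma trace_norm_sqr_le d (A : 'M[C]_d) (t : R) : hermitian A ->
  is_trace_norm A t -> t ^+ 2 <= d%:R * Re (\tr (A *m A)).
Proof.
move=> hA [S [[hS _] SS tS]]; rewrite hA in SS; rewrite -SS.
(* Dimension 0 has no maximally mixed state and is settled apart. *)
case: d A hA S hS SS tS => [|d] A hA S hS SS tS.
  by rewrite -tS /mxtrace big_ord0 /= mul0r expr0n.
set n := d.+1 in A hA S hS SS tS *.
have n0 : 0 < n%:R :> R by rewrite ltr0n.
have ni0 : 0 <= n%:R^-1 :> R by rewrite invr_ge0 ltW.
pose B : 'M[C]_n := (rc n%:R^-1)%:M.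
have trB : \tr B = 1.
  by rewrite mxtrace_scalar -rmorphMn -(mulr_natr _ n) mulVf ?gt_eqF.
have hE : \tr (S *m B) = rc (t / n%:R).
  rewrite mul_mx_scalar mxtraceZ.
  have -> : \tr S = rc t by rewrite -tS; apply: conjc_fixed_real; rewrite -mxtrace_adjmx hS.
  by rewrite -rmorphM mulrC.
have hX : hermitian (S - (\tr (S *m B))%:M).
  by apply/hermitianB/hermitian_scalar => //; rewrite hE conjc_real.
have := mxtrace_centered_sqr S trB; move: hX; rewrite hE.
set X := S - _ => hX /=; rewrite /B !mul_mx_scalar !mxtraceZ => XE.
have : 0 <= Re (rc n%:R^-1 * \tr (X *m X)).
  by rewrite ReZ mulr_ge0 //; apply/psd_mxtrace_ge0/psd_sqr.
rewrite XE ReB !ReZ /= subr_ge0 => h.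
have := ler_wpM2l (ltW (exprn_gt0 2 n0)) h.
have -> : n%:R ^+ 2 * (t / n%:R * (t / n%:R)) = t ^+ 2 by field; rewrite gt_eqF.
have -> // : n%:R ^+ 2 * (n%:R^-1 * Re (\tr (S *m S))) = n%:R * Re (\tr (S *m S)).
by field; rewrite gt_eqF.
Qed.

Lemma hermitian_avg d T (rho : 'I_T -> 'M[C]_d) :
  (forall t, is_state (rho t)) -> hermitian (avg_state rho).
Proof.
move=> srho; apply: hermitianZ; first by rewrite conjc_inv rmorph_nat.
by apply: hermitian_sum => t _; case: (srho t) => -[].
Qed.

Lemma trace_tester d T (eps : R) : 0 < eps ->
  1000 * (1000 * 1000) * d%:R <= T%:R * eps ^+ 2 ->
  exists M : 'M[C]_(prod_dim d T), is_effect M /\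
    forall rho sigma : 'I_T -> 'M[C]_d,
      (forall t, is_state (rho t)) -> (forall t, is_state (sigma t)) ->
      (avg_state rho = avg_state sigma -> 99 / 100 <= accept_prob M rho sigma) /\
      (Dtr_gt (avg_state rho) (avg_state sigma) eps ->
         accept_prob M rho sigma <= 1 / 100).
Proof.
move=> e0 hT; have [d0|d0] := posnP d.
  (* For d = 0 the threshold eps^2 / d is meaningless. Always accepting works: trace norms vanish,
     so the second case never occurs. *)
  subst d; exists 1%:M; split.
    split; first by have := psd_gram (1%:M : 'M[C]_(prod_dim 0 T));
      rewrite adjmx_scalar conjc1 mulmx1.
    by have := psd_gram (0 : 'M[C]_(prod_dim 0 T)); rewrite subrr mulmx0.
  move=> rho sigma srho ssigma; split=> [_|[t [[S [_ _ <-]]]]].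
    have sw k : is_state (joint_family rho sigma k) by rewrite /joint_family; case: split.
    have := (tens_state sw).2; rewrite /accept_prob mul1mx.
    have -> : prod_state rho sigma = tens (joint_family rho sigma) by [].
    by move=> -> /=; lra.
  by rewrite /mxtrace big_ord0 /= mul0r => /(lt_trans e0); rewrite ltxx.
have dR : 0 < d%:R :> R by rewrite ltr0n.
have [|M [effM hM]] := @hs_tester d T (eps ^+ 2 / d%:R).
  by rewrite [leRHS]mulrA ler_pdivlMr.
exists M; split=> // rho sigma srho ssigma; have [h1 h2] := hM _ _ srho ssigma; split.
  move=> e; apply: h1; rewrite e /DHS2 subrr mulmx0 raddf0 /=.
  by rewrite mulr_ge0 ?divr_ge0 ?sqr_ge0 ?ltW.
(* From 2 eps < t follows eps^2 < t^2 <= d D_HS^2. *)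
case=> t [tn et]; apply: h2; rewrite ltr_pdivrMr // mulrC.
have := trace_norm_sqr_le (hermitianB (hermitian_avg srho) (hermitian_avg ssigma)) tn.
apply: lt_le_trans; rewrite ltr_pXn2r ?nnegrE //; lra.
Qed.

End Testing.

Theorem theorem2p5 :
  exists K : nat, (0 < K)%N /\ forall R : realType,
  (* (i) Hilbert-Schmidt tolerant testing *)
  (forall (d T : nat) (theta : R), 0 <= theta -> K%:R <= T%:R * theta ->
    exists M : 'M[R[i]]_(prod_dim d T), is_effect M /\
      forall rho sigma : 'I_T -> 'M[R[i]]_d,
        (forall t, is_state (rho t)) -> (forall t, is_state (sigma t)) ->
        (DHS2 (avg_state rho) (avg_state sigma) <= 99 / 100 * theta ->
           99 / 100 <= accept_prob M rho sigma) /\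
        (theta < DHS2 (avg_state rho) (avg_state sigma) ->
           accept_prob M rho sigma <= 1 / 100)) /\
  (* (ii) trace-distance identity testing *)
  (forall (d T : nat) (eps : R), 0 < eps -> K%:R * d%:R <= T%:R * eps ^+ 2 ->
    exists M : 'M[R[i]]_(prod_dim d T), is_effect M /\
      forall rho sigma : 'I_T -> 'M[R[i]]_d,
        (forall t, is_state (rho t)) -> (forall t, is_state (sigma t)) ->
        (avg_state rho = avg_state sigma ->
           99 / 100 <= accept_prob M rho sigma) /\
        (Dtr_gt (avg_state rho) (avg_state sigma) eps ->
           accept_prob M rho sigma <= 1 / 100)).
Proof.
(* The constant is the one required by [variance_le]. *)
exists (10 ^ 9)%N; split; first by rewrite expn_gt0.
move=> R; have KE : (10 ^ 9)%:R = 1000 * (1000 * 1000) :> R by rewrite natrX; ring.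
split=> d T a a0; rewrite KE; [exact: hs_tester | exact: trace_tester].
Qed.
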